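(* For $n,k\ge 0$ let $v_{n,k}$ be the number of ascent-marked Stirling permutations of size $n$ with exactly $k$ dots. The numbers $v_{n,k}$ satisfy, for $n\ge 1$ and $k\ge0$, the recurrence $$v_{n,k} = (2n-k-1)\,\big(v_{n-1,k}+v_{n-1,k-1}\big)$$ with initial conditions $v_{0,k}=\delta_{k0}$ and $v_{n,-1}=0$. Therefore $\left[{n\atop k}\right]^{(2)} = v_{n,n-k}$ for $0\le k\le n$.
   Context: A Stirling permutation of size $n$ is a permutation (word) of the multiset $\{1,1,2,2,\ldots,n,n\}$ such that for every $i\in[n]$ all entries between the two occurrences of $i$ exceed $i$. An ascent of a word $a_1\cdots a_{2n}$ is a pair of consecutive letters $a_i,a_{i+1}$ with $a_i<a_{i+1}$. An ascent-marked Stirling permutation of size $n$ is a Stirling permutation of size $n$ in which a dot may or may not be inserted in each ascent (between $a_i$ and $a_{i+1}$); equivalently, a Stirling permutation together with a chosen subset of its ascents (the dotted ones). $\left[{n\atop k}\right]^{(2)}$ is the number of permutations of $[n+k]$ with exactly $k$ cycles, all of size $\ge 2$. *)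

(* Defs.v *)
From mathcomp Require Import all_boot all_order all_algebra all_fingroup.

Set Implicit Arguments.
Unset Strict Implicit.
Unset Printing Implicit Defensive.

(* The letters 1, ..., n are represented by the elements 0, ..., n-1 of 'I_n;
   only their order matters. *)
Definition stirling_perm (n : nat) (w : (2 * n).-tuple 'I_n) : bool :=
  [forall a : 'I_n, count_mem a w == 2] &&
  [forall i : 'I_(2 * n), forall j : 'I_(2 * n), forall l : 'I_(2 * n),
     [&& i < j, j < l & tnth w i == tnth w l] ==> (tnth w i < tnth w j)].

(* An ascent is identified with the position of its first letter. *)
Definition ascents (n : nat) (w : (2 * n).-tuple 'I_n) : {set 'I_(2 * n)} :=
  [set i : 'I_(2 * n) |
     [exists j : 'I_(2 * n), (j == i.+1 :> nat) && (tnth w i < tnth w j)]].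

(* A pair (w, D): D is the set of dotted ascents of w. *)
Definition ascent_marked_stirling_perms (n : nat) :
    {set (2 * n).-tuple 'I_n * {set 'I_(2 * n)}} :=
  [set m : (2 * n).-tuple 'I_n * {set 'I_(2 * n)} |
     stirling_perm m.1 & m.2 \subset ascents m.1].

(* The number of dots ranges over int, so that v n (-1) makes sense. *)
Definition v (n : nat) (k : int) : nat :=
  #|[set m in ascent_marked_stirling_perms n | #|m.2|%:Z%R == k]|.

Definition assoc_stirling1 (n k : nat) : nat :=
  #|[set s : 'S_(n + k) |
       (#|porbits s| == k) && [forall C in porbits s, 2 <= #|C|]]|.

(* Main.v *)
Require Import Defs.
From mathcomp Require Import all_boot all_order all_algebra all_fingroup.
From mathcomp Require Import zify.

Set Implicit Arguments.
Unset Strict Implicit.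
Unset Printing Implicit Defensive.

(* Deleting the two adjacent copies of the largest letter n is a bijection from
   Stirling words of size n+1 onto pairs of a Stirling word of size n and one of
   2n+1 insertion positions.  Insertion in front or inside an ascent keeps the
   number a of ascents, every other insertion adds one, so that
     v(n+1,k) = sum over words of (a+1) C(a,k) + (2n-a) C(a+1,k),
   and (k+1) C(a,k+1) = (a-k) C(a,k) turns this into the recurrence.

   On the cycle side, write a permutation s moving x as (x y) s' with s' x = x
   and y = s^-1 x: passing to s' only removes x from its cycle, and moves all
   points moved by s except x (or x and y when they form a 2-cycle).  This gives
   d(m+2,k) = (m+1) (d(m+1,k) + d(m,k-1)) for derangements of m points with k
   cycles, which is the same recurrence after m = n+k. *)

(** * Stirling words built by inserting the largest letter twice *)

Definition insert2 (m : nat) (u : seq nat) (p : nat) : seq nat :=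
  take p u ++ [:: m, m & drop p u].

Fixpoint stirling_words (n : nat) : seq (seq nat) :=
  if n is m.+1 then
    [seq insert2 m u p | u <- stirling_words m, p <- iota 0 (2 * m).+1]
  else [:: [::]].

Lemma stirling_wordsS n :
  stirling_words n.+1 =
    [seq insert2 n u p | u <- stirling_words n, p <- iota 0 (2 * n).+1].
Proof. by []. Qed.

(** The betweenness condition is put as a pattern condition because that form passes to
    subsequences, hence survives deletion of letters. *)
Definition stirling_word (n : nat) (s : seq nat) : Prop :=
  [/\ size s = 2 * n, forall a, count_mem a s = 2 * (a < n)
    & forall a b, subseq [:: a; b; a] s -> a < b].

Lemma stirling_word_notin n u : stirling_word n u -> n \notin u.
Proof. by case=> _ cu _; apply/count_memPn; rewrite cu ltnn. Qed.

Lemma filter_insert2 m u p : m \notin u -> filter (predC1 m) (insert2 m u p) = u.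
Proof.
move=> mu; rewrite /insert2 filter_cat /= eqxx /= -filter_cat cat_take_drop.
by apply/all_filterP/allP => x xu /=; apply: contraNneq mu => <-.
Qed.

Lemma index_insert2 m u p : m \notin u -> p <= size u -> index m (insert2 m u p) = p.
Proof.
move=> mu pu; rewrite /insert2 index_cat /= eqxx addn0 size_takel //.
by rewrite ifN //; apply: contra mu; apply: mem_take.
Qed.

Lemma subseq_cons_catN (T : eqType) (x : T) s s1 s2 :
  x \notin s1 -> subseq (x :: s) (s1 ++ s2) = subseq (x :: s) s2.
Proof.
elim: s1 => //= y s1 IH; rewrite inE negb_or => /andP[/negPf xy xs1].
by rewrite xy IH.
Qed.

(** A pattern [a b a] avoiding [n] survives the removal of [n], hence occurs in [u]. If only [b] is
    [n], then [a] is a letter of [u]. The case [a = n] would need a third [n] or a letter between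
    the adjacent copies. *)
Lemma insert2_stirling_word n u p :
  stirling_word n u -> stirling_word n.+1 (insert2 n u p).
Proof.
move=> su; have nu := stirling_word_notin su; case: su => zu cu au.
split.
- by rewrite /insert2 size_cat /= !addnS -size_cat cat_take_drop zu; lia.
- move=> a; rewrite /insert2 count_cat /= !(addnCA (count _ _)) -count_cat.
  by rewrite cat_take_drop cu; lia.
move=> a b; have [-> {a}|an] := eqVneq a n; last first.
  have [-> {b}|bn] := eqVneq b n.
    move=> /mem_subseq /(_ a); rewrite !inE eqxx => /(_ isT).
    rewrite mem_cat !inE (negPf an) /= -mem_cat cat_take_drop -has_pred1 has_count cu.
    by lia.
  move=> sab; apply: au; rewrite -(filter_insert2 p nu) subseq_filter sab.
  by rewrite /= an bn.
rewrite /insert2 subseq_cons_catN; last by apply: contra nu; apply: mem_take.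
rewrite /= eqxx.
have nd : n \notin drop p u by apply: contra nu; apply: mem_drop.
have [_|bn] := eqVneq b n.
  by rewrite sub1seq (negPf nd).
move=> /mem_subseq /(_ n); rewrite !inE eqxx orbT => /(_ isT).
by rewrite (negPf nd).
Qed.

(** A letter other than [n] right after the first [n] would lie between the two copies and exceed
    the largest letter; so the copies are adjacent. *)
Lemma stirling_word_delete n s :
  stirling_word n.+1 s ->
  exists2 u, stirling_word n u & exists2 p, p < (2 * n).+1 & s = insert2 n u p.
Proof.
case=> zs cs subs.
have ns : n \in s by rewrite -has_pred1 has_count cs ltnSn.
pose p := index n s; pose t := take p s; pose d := drop p.+1 s.
have sE : s = t ++ n :: d by rewrite -drop_index // cat_take_drop.
have nt : n \notin t by rewrite in_take // ltnn.
have zt : size t = p by rewrite size_takel // ltnW // index_mem.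
have := cs n; rewrite {1}sE count_cat /= eqxx (count_memPn nt) ltnSn => cn.
case: d sE cn => [|b d] sE //= cn.
have bn : b = n.
  apply/eqP; apply: contraT => bn.
  have nd : n \in d.
    rewrite -has_pred1 has_count.
    by move: cn; rewrite (negPf bn) => -[]; rewrite !add0n => ->.
  have : n < b.
    apply: subs; rewrite sE; apply: subseq_trans (suffix_subseq _ _).
    by rewrite /= !eqxx sub1seq.
  have : b \in s by rewrite sE mem_cat !inE eqxx !orbT.
  by rewrite -has_pred1 has_count cs; move: bn; lia.
subst b.
have nd : n \notin d by apply/count_memPn; move: cn; rewrite eqxx !add0n => -[].
have sI : s = insert2 n (t ++ d) p.
  by rewrite /insert2 -zt take_size_cat // drop_size_cat.
exists (t ++ d); last first.
  exists p => //; move: zs; rewrite sE !size_cat /= zt; lia.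
split.
- by move: zs; rewrite sE !size_cat /=; lia.
- move=> a; have := cs a; rewrite sE !count_cat /=.
  have [<-|an] := eqVneq n a; last by move: an; lia.
  by rewrite (count_memPn nt) (count_memPn nd) ltnn.
move=> a b sab; apply: subs; apply: subseq_trans sab _.
by rewrite sE cat_subseq //; apply: (suffix_subseq [:: n; n]).
Qed.

Lemma mem_stirling_words n s : s \in stirling_words n <-> stirling_word n s.
Proof.
elim: n s => [|n IH] s.
  rewrite inE; split=> [/eqP ->|[/size0nil ->]] //; by split.
rewrite stirling_wordsS.
split=> [/allpairsP[[u p] /= [/IH su _ ->]]|]; first exact: insert2_stirling_word.
move=> /stirling_word_delete[u /IH su [p pn ->]].
by apply: allpairs_f; rewrite // mem_iota add0n.
Qed.

(** Removing [n] recovers [u], and the index of [n] recovers [p]. *)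
Lemma uniq_stirling_words n : uniq (stirling_words n).
Proof.
elim: n => // n IH; rewrite stirling_wordsS; apply: allpairs_uniq => //.
  exact: iota_uniq.
move=> x y /allpairsP[[u p] [/mem_stirling_words su pn ->]].
move=> /allpairsP[[u' p'] [/mem_stirling_words su' pn' ->]] e.
rewrite /= in su su' e.
move: pn pn'; rewrite !mem_iota !add0n !ltnS => /= pn pn'.
have nu := stirling_word_notin su; have nu' := stirling_word_notin su'.
have eu : u = u' by rewrite -(filter_insert2 p nu) e filter_insert2.
have zu : size u' = 2 * n by case: su'.
have ep : p = p'.
  have <- : index n (insert2 n u p) = p by apply: index_insert2; rewrite // eu zu.
  by rewrite e index_insert2 ?zu.
by rewrite eu ep.
Qed.

(** * Ascents under insertion, and the recurrence for words *)

(** No letter is below the default 0 of [head], so the last position never counts. *)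
Fixpoint asc (s : seq nat) : nat :=
  if s is x :: s' then (x < head 0 s') + asc s' else 0.

Lemma ascE s : asc s = \sum_(i < size s) (nth 0 s i < nth 0 s i.+1).
Proof.
elim: s => [|x s IH] /=; first by rewrite big_ord0.
by rewrite big_ord_recl IH /= nth0.
Qed.

(** Behind the letter at [p] a new ascent to [n] appears, and the descent from [n] replaces whatever
    stood there: the gain is one unless [p] was an ascent. *)
Lemma asc_insert2S n u p : all (ltn^~ n) u -> p < size u ->
  asc (insert2 n u p.+1) = asc u + ~~ (nth 0 u p < nth 0 u p.+1).
Proof.
rewrite /insert2; elim: u p => [|x u IH] p //= /andP[xn un].
case: p => [_|p] /=.
  rewrite take0 drop0 /= xn ltnn nth0.
  case: u un {IH} => [|y u] /=; first by lia.
  by case/andP=> yn _; rewrite ltnNge (ltnW yn) /=; lia.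
rewrite ltnS => pu; rewrite IH // addnA; congr (_ + _ + _).
by case: u un pu {IH} => [|y u].
Qed.

Lemma asc_insert2_0 n u : all (ltn^~ n) u -> asc (insert2 n u 0) = asc u.
Proof.
rewrite /insert2 take0 drop0 /= ltnn; case: u => //= y u /andP[yn _]; lia.
Qed.

(** The term [asc u * F (asc u).+1] is added on the left to avoid the subtraction
    [2 * n - asc u]. *)
Lemma sum_asc_insert2 n u (F : nat -> nat) : stirling_word n u ->
  \sum_(p < (2 * n).+1) F (asc (insert2 n u p)) + asc u * F (asc u).+1 =
  (asc u).+1 * F (asc u) + 2 * n * F (asc u).+1.
Proof.
move=> [zu cu _].
have un : all (ltn^~ n) u.
  by apply/allP => x; rewrite -has_pred1 has_count cu /=; lia.
rewrite big_ord_recl asc_insert2_0 // (mulSn (asc u)) -!addnA.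
apply/eqP; rewrite eqn_add2l; apply/eqP.
pose b (p : 'I_(2 * n)) := nth 0 u p < nth 0 u p.+1.
have aE x : asc u * x = \sum_p b p * x by rewrite ascE zu big_distrl.
rewrite (eq_bigr (fun p => F (asc u + ~~ b p))) => [|p _]; last first.
  by rewrite lift0 asc_insert2S ?zu.
have -> : 2 * n * F (asc u).+1 = \sum_(p < 2 * n) F (asc u).+1.
  by rewrite sum_nat_const card_ord.
rewrite !aE -!big_split; apply: eq_bigr => p _ /=.
by case: (b p); rewrite /= ?addn1 ?addn0; lia.
Qed.

Definition marked (n k : nat) := \sum_(s <- stirling_words n) 'C(asc s, k).

(** The binomial of [a] over [k - 1], with value 0 at [k = 0], where the truncated [k.-1] would give
    1. *)
Definition bin_pred (a k : nat) := if k is k'.+1 then 'C(a, k') else 0.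

(** The recurrence with factor [2n + 1 - k], its negative part moved to the left; it holds word by
    word. *)
Lemma markedS n k :
  marked n.+1 k + k * \sum_(s <- stirling_words n) ('C(asc s, k) + bin_pred (asc s) k) =
  (2 * n).+1 * \sum_(s <- stirling_words n) ('C(asc s, k) + bin_pred (asc s) k).
Proof.
rewrite /marked stirling_wordsS big_allpairs_dep !big_distrr -big_split.
apply: eq_big_seq => u /mem_stirling_words su.
rewrite -[X in iota 0 X]subn0 -/(index_iota _ _) big_mkord.
have := sum_asc_insert2 (fun a => 'C(a, k)) su; move: (\sum_(p < _) _) => S.
case: k => [|k] /=; first by rewrite !bin0; lia.
have := mul_bin_left (asc u) k; rewrite binS.
(* The subtraction [asc u - k] is exact when [k <= asc u]; otherwise both binomials of [asc u]
   vanish. *)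
by case: (leqP k (asc u)) => h; [|rewrite !bin_small //]; nia.
Qed.

(** * From lists of numbers to tuples and marked permutations *)

Lemma subseq_consP (T : eqType) (x0 x : T) s t :
  subseq (x :: s) t <->
  exists2 i, i < size t & nth x0 t i = x /\ subseq s (drop i.+1 t).
Proof.
split=> [|[i it [<- st]]]; last first.
  rewrite -[X in subseq _ X](cat_take_drop i) (drop_nth x0 it).
  by apply: subseq_trans (suffix_subseq _ _); rewrite /= eqxx.
elim: t => //= y t IH; case: eqVneq => [->|_] st.
  by exists 0; rewrite ?drop0.
by have [i it e] := IH st; exists i.+1.
Qed.

Lemma subseq3P (T : eqType) (x0 a b c : T) t :
  subseq [:: a; b; c] t <->
  exists i j l, [/\ i < j, j < l, l < size t
    & [:: nth x0 t i; nth x0 t j; nth x0 t l] = [:: a; b; c]].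
Proof.
split=> [|[i [j [l [ij jl lt [<- <- <-]]]]]].
  case/(subseq_consP x0) => i it [<-] /(subseq_consP x0)[j + [<-]].
  rewrite size_drop ltn_subRL => jt /(subseq_consP x0)[l + [<- _]].
  rewrite !size_drop drop_drop !nth_drop => lt.
  exists i, (i.+1 + j), (l.+1 + j.+1 + i); split; try lia.
  by congr [:: _; _; nth _ _ _]; lia.
have it : i < size t by lia.
apply/(subseq_consP x0); exists i => //; split=> //.
apply/(subseq_consP x0); exists (j - i.+1); first by rewrite size_drop; lia.
rewrite nth_drop drop_drop subnKC //; split=> //.
rewrite (_ : (j - i.+1).+1 + i.+1 = j.+1); last by lia.
by rewrite sub1seq -[l](subnKC jl) -nth_drop mem_nth // size_drop; lia.
Qed.

Lemma stirling_permP n (w : (2 * n).-tuple 'I_n) :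
  stirling_perm w <-> stirling_word n (map val w).
Proof.
have cE (a : 'I_n) : count_mem (val a) (map val w) = count_mem a w.
  by rewrite count_map; apply: eq_count => b /=; rewrite (inj_eq val_inj).
have nE (i : 'I_(2 * n)) : nth 0 (map val w) i = tnth w i.
  by rewrite (nth_map (tnth_default w i)) ?size_tuple // -tnth_nth.
split=> [/andP[/forallP cw /forallP sw]|[_ cw sw]].
  split; first by rewrite size_map size_tuple.
    move=> a; case: ltnP => an; first by rewrite (cE (Ordinal an)); apply/eqP.
    apply/count_memPn/mapP => -[b _ e].
    by have := ltn_ord b; rewrite -[nat_of_ord b]e; lia.
  move=> a b /(subseq3P 0)[i [j [l []]]]; rewrite size_map size_tuple => ij jl lw.
  have jw := ltn_trans jl lw; have iw := ltn_trans ij jw.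
  have := sw (Ordinal iw) => /forallP/(_ (Ordinal jw))/forallP/(_ (Ordinal lw)).
  rewrite (nE (Ordinal iw)) (nE (Ordinal jw)) (nE (Ordinal lw)) /= ij jl /=.
  by move=> /implyP h [<- <- /val_inj e]; apply: h; rewrite e.
apply/andP; split.
  by apply/forallP => a; rewrite -cE cw ltn_ord.
apply/forallP => i; apply/forallP => j; apply/forallP => l.
apply/implyP => /and3P[ij jl /eqP il]; apply: sw; apply/(subseq3P 0).
exists i, j, l; rewrite size_map size_tuple ltn_ord; split=> //.
by rewrite !nE il.
Qed.

Lemma card_ascents n (w : (2 * n).-tuple 'I_n) : #|ascents w| = asc (map val w).
Proof.
have nE (i : 'I_(2 * n)) : nth 0 (map val w) i = tnth w i.
  by rewrite (nth_map (tnth_default w i)) ?size_tuple // -tnth_nth.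
rewrite ascE size_map size_tuple -sum1_card big_mkcond /=.
apply: eq_bigr => i _; rewrite inE nE.
case: existsP => [[j /andP[/eqP <- ij]]|h]; first by rewrite nE ij.
case: ltnP => // lt_i; case: h.
have [iw|wi] := ltnP i.+1 (2 * n); last first.
  by move: lt_i; rewrite nth_default ?size_map ?size_tuple.
by exists (Ordinal iw); rewrite /= eqxx -(nE (Ordinal iw)).
Qed.

Lemma perm_stirling_words n :
  perm_eq (stirling_words n)
    [seq map val (tval w) | w <- enum (@stirling_perm n)].
Proof.
apply: uniq_perm; first exact: uniq_stirling_words.
  rewrite map_inj_uniq ?enum_uniq // => w1 w2 /(inj_map val_inj) e.
  exact: val_inj.
move=> s; apply/idP/mapP => [/mem_stirling_words sw|[w]]; last first.
  by rewrite mem_enum => /stirling_permP sw ->; apply/mem_stirling_words.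
have [zs cs _] := sw.
(* All letters of [s] are below [n], so [insub] drops none. *)
have sE : map val (pmap (insub : nat -> option 'I_n) s) = s.
  rewrite (pmap_filter (insubK _)); apply/all_filterP/allP => x.
  by rewrite -has_pred1 has_count cs => h; rewrite insubT /=; lia.
have zw : size (pmap (insub : nat -> option 'I_n) s) == 2 * n.
  by rewrite -(size_map val) sE zs.
exists (Tuple zw); rewrite /= ?sE // mem_enum.
by apply/stirling_permP; rewrite /= sE.
Qed.

(** For a fixed word, the dots are a [k]-subset of its ascents. *)
Lemma v_marked n k : v n (k%:Z)%R = marked n k.
Proof.
rewrite /v -sum1_card.
rewrite (eq_bigl (fun m : (2 * n).-tuple 'I_n * {set 'I_(2 * n)} =>
    stirling_perm m.1 && ((m.2 \subset ascents m.1) && (#|m.2| == k)))); last first.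
  by move=> m; rewrite !inE andbA.
rewrite -(pair_big_dep (@stirling_perm n)
  (fun w (D : {set 'I_(2 * n)}) => (D \subset ascents w) && (#|D| == k))
  (fun _ _ => 1)) /=.
under eq_bigr do rewrite sum1dep_card cards_draws card_ascents.
by rewrite /marked (perm_big _ (perm_stirling_words n)) big_map big_enum.
Qed.

(** * Derangements counted by cycles *)

Import GroupScope.

Section PermsWithSupport.

Variable T : finType.
Implicit Types (A : {set T}) (s : {perm T}) (x y : T).

Definition moved s : {set T} := [set x | s x != x].

(* For [j = k + #|T|]: the derangements of A with k cycles, since each point
   outside A contributes a singleton to [porbits s].  The shift by #|T| avoids
   subtraction and lets k drop by one with j. *)
Definition support_perms A j : {set {perm T}} :=
  [set s : {perm T} | (moved s == A) && (#|porbits s| + #|A| == j)%N].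

Lemma porbit_fix s x : s x = x -> porbit s x = [set x].
Proof.
move=> sx; apply/setP => y; rewrite inE; apply/porbitP/eqP => [[i ->]|->].
  by rewrite permX; elim: i => //= i ->.
by exists 0%N; rewrite expg0 perm1.
Qed.

(** The transposition merges the singleton orbit of [x] into the orbit of [y]. *)
Lemma card_porbits_tperm_fix s x y : s x = x -> y != x ->
  #|porbits s| = #|porbits (tperm x y * s)|.+1.
Proof.
move=> sx yx; have := porbits_mul_tperm s x y => /=.
rewrite porbit_sym porbit_fix // inE yx eq_sym yx /=; lia.
Qed.

Lemma moved_tperm_fix s x y : s x = x -> y != x ->
  moved (tperm x y * s) = x |: (y |: moved s).
Proof.
move=> sx yx; apply/setP => z; rewrite !inE permM.
case: tpermP => [->|->|/eqP/negPf -> /eqP/negPf ->] //; rewrite ?eqxx ?orbT //=.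
  by apply: contraNneq yx => syx; rewrite -(inj_eq (@perm_inj _ s)) sx syx.
by rewrite sx eq_sym (negPf yx).
Qed.

(* The first summand is the case [y \in M], the second [y \notin M]. *)
Lemma setU2_eq A (M : {set T}) x y : x \notin M -> y \in A :\ x -> x \in A ->
  ((x |: (y |: M) == A) : nat) = ((M == A :\ x) + (M == A :\ x :\ y))%N.
Proof.
move=> xM yA xA; have [yM|yM] := boolP (y \in M).
  have /negPf -> : M != A :\ x :\ y.
    by apply: contraTneq yM => ->; rewrite !inE eqxx.
  rewrite (@setUidPr _ [set y] M _) ?sub1set //= addn0; congr nat_of_bool.
  apply/eqP/eqP => [<-|->]; first by rewrite setU1K.
  by rewrite setD1K.
have /negPf -> : M != A :\ x by apply: contraNneq yM => ->.
rewrite /= add0n; congr nat_of_bool; apply/eqP/eqP => [<-|->]; last by rewrite !setD1K.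
rewrite setU1K ?setU1K //; move: yA; rewrite !inE negb_or xM eq_sym => /andP[->] //.
Qed.

(** Cutting [x] out of its cycle adds one orbit. If [y] stays moved, the support loses one point and
    [j] is unchanged; if [y] becomes fixed too, the support loses two points and [j] drops by
    one. *)
Lemma card_support_permsS A x j : x \in A ->
  #|support_perms A j| =
  (\sum_(y in A :\ x) (#|support_perms (A :\ x) j| +
    if j is j'.+1 then #|support_perms (A :\ x :\ y) j'| else 0))%N.
Proof.
move=> xA; rewrite -sum1_card.
rewrite (partition_big (fun s : {perm T} => s^-1 x) (mem (A :\ x))) /=; last first.
  move=> s; rewrite !inE => /andP[/eqP sA _].
  have sx : s^-1 x != x.
    by move: xA; rewrite -sA inE; apply: contraNneq => {1}<-; rewrite permKV.
  by rewrite sx -sA inE permKV eq_sym.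
(* With [s] replaced by [tperm x y * s], the condition that the preimage of [x] is [y] becomes
   [s x = x]. *)
apply: eq_bigr => y yA; rewrite (reindex_inj (mulgI (tperm x y))) /=.
have yx : y != x by move: yA; rewrite !inE => /andP[].
have cA : #|A| = #|A :\ x :\ y|.+2 by rewrite (cardsD1 x A) xA (cardsD1 y) yA.
have cAx : #|A :\ x| = #|A :\ x :\ y|.+1 by rewrite (cardsD1 y) yA.
have -> : #|support_perms (A :\ x) j| = \sum_s (s \in support_perms (A :\ x) j)%N.
  by rewrite -sum1_card big_mkcond.
have -> : (if j is j'.+1 then #|support_perms (A :\ x :\ y) j'| else 0%N) =
    \sum_s (if j is j'.+1 then (s \in support_perms (A :\ x :\ y) j') : nat
            else 0)%N.
  by case: j => [|j]; [rewrite big1|rewrite -sum1_card big_mkcond].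
rewrite -big_split /= big_mkcond; apply: eq_bigr => s _.
rewrite -(inj_eq (@perm_inj _ (tperm x y * s))) permKV permM tpermR eq_sym !inE.
have [sx|sx] := eqVneq (s x) x; last first.
  have xm : x \in moved s by rewrite inE.
  have nm (B : {set T}) : x \notin B -> (moved s == B) = false.
    by move=> xB; apply/negbTE; apply: contraNneq xB => <-.
  rewrite andbF nm ?inE ?eqxx //.
  by case: j => // j; rewrite inE nm // !inE eqxx andbF.
have := setU2_eq (M := moved s) _ yA xA; rewrite inE sx eqxx => /(_ isT).
rewrite moved_tperm_fix // andbT cA cAx.
set b := _ == A; case: j => [|j]; rewrite ?inE (card_porbits_tperm_fix sx yx).
  by rewrite !addnS !andbF.
rewrite !addnS !addSn !eqSS.
by case: (_.+1 == _); rewrite ?andbT ?andbF //; case: b.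
Qed.

Fixpoint cyclic_derangements (m k : nat) : nat :=
  match m with
  | 0 => k == 0
  | 1 => 0
  | (m'.+1 as m1).+1 =>
      m1 * (cyclic_derangements m1 k +
            if k is k'.+1 then cyclic_derangements m' k' else 0)
  end.

Lemma cyclic_derangementsSS m k :
  cyclic_derangements m.+2 k =
  (m.+1 * (cyclic_derangements m.+1 k +
           if k is k'.+1 then cyclic_derangements m k' else 0))%N.
Proof. by []. Qed.

Lemma card_support_perms A j :
  #|support_perms A j| =
  (if #|T| <= j then cyclic_derangements #|A| (j - #|T|) else 0)%N.
Proof.
have [m] := ubnP #|A|; elim: m A j => // m IH A j Am.
have [->|/set0Pn[x xA]] := eqVneq A set0.
  have -> : support_perms set0 j = if j == #|T| then [set 1] else set0.
    apply/setP => s; rewrite inE cards0 addn0.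
    have -> : (moved s == set0) = (s == 1).
      apply/eqP/eqP => [/setP s0|->]; last by apply/setP => y; rewrite !inE perm1 eqxx.
      by apply/permP => y; have := s0 y; rewrite !inE perm1 => /negbFE/eqP.
    have [->|s1] := eqVneq s 1; last by case: ifP; rewrite inE // (negPf s1).
    have -> : #|porbits (1 : {perm T})| = #|T|.
      rewrite /porbits card_imset ?cardsT // => y z.
      by rewrite !porbit_fix ?perm1 // => /set1_inj.
    by rewrite eq_sym; case: ifP; rewrite inE ?eqxx.
  rewrite cards0 /= subn_eq0.
  by case: (ltngtP j #|T|) => h; rewrite ?cards1 ?cards0.
rewrite (card_support_permsS _ xA).
have [c cA] : exists c, #|A| = c.+1 by exists #|A :\ x|; rewrite (cardsD1 x) xA.
have cAx : #|A :\ x| = c by move: cA; rewrite (cardsD1 x) xA; lia.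
rewrite (eq_bigr (fun=> if #|T| <= j then cyclic_derangements c (j - #|T|) +
   if j - #|T| is k.+1 then cyclic_derangements c.-1 k else 0 else 0)%N); last first.
  move=> y yA; have cAy : #|A :\ x :\ y| = c.-1 by rewrite -cAx (cardsD1 y (A :\ x)) yA.
  rewrite IH ?cAx; last by lia.
  case: j => [|j]; first by rewrite addn0 sub0n addn0.
  rewrite IH cAy; last by lia.
  case: (leqP #|T| j) => h.
    by rewrite (leqW h) subSn.
  (* Only [j.+1 = #|T|] remains, that is, zero cycles, where the second summand is 0 on both
     sides. *)
  by rewrite addn0; case: leqP => // h'; rewrite (_ : (j.+1 - _ = 0)%N) ?addn0 //; lia.
rewrite sum_nat_const cAx cA; case: ifP => _; last by rewrite muln0.
(* For [c = 0] both sides are 0: no permutation moves exactly one point. *)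
by case: c {cA cAx} => [|c].
Qed.

End PermsWithSupport.

(** All cycles have size at least 2 exactly when every point is moved, so this is the case of full
    support. *)
Lemma assoc_stirling1E n k : assoc_stirling1 n k = cyclic_derangements (n + k) k.
Proof.
have := card_support_perms [set: 'I_(n + k)] (k + (n + k)).
rewrite cardsT card_ord leq_addl addnK => <-.
apply: eq_card => s; rewrite !inE andbC cardsT card_ord eqn_add2r; congr (_ && _).
apply/forallP/eqP => [h|/setP h C].
  apply/setP => x; rewrite !inE; apply/negP => /eqP sx.
  have := h (porbit s x); rewrite imset_f //= porbit_fix // cards1 //.
apply/implyP => /imsetP[x _ ->].
have := h x; rewrite !inE => /negPf sx.
have /subset_leq_card : [set x; s x] \subset porbit s x.
  by rewrite subUset !sub1set porbit_id (mem_porbit s 1).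
by rewrite cards2 eq_sym sx.
Qed.

(** Each of the [k] cycles needs two points; both terms of the recurrence inherit the inequality. *)
Lemma cyclic_derangements_small m k : (m < 2 * k)%N -> cyclic_derangements m k = 0%N.
Proof.
have [b] := ubnP m; elim: b m k => // b IH [|[|m]] k mb mk //.
  by case: k mk.
rewrite cyclic_derangementsSS IH; [|lia|lia].
case: k mk => [|k] mk; first by move: mk; rewrite muln0.
by rewrite IH ?muln0; lia.
Qed.

(** * The integer recurrence and the comparison of both counts *)

Import GRing.Theory.
Local Open Scope ring_scope.

Lemma v_neg n (z : int) : z < 0 -> v n z = 0%N.
Proof.
move=> z0; apply/eqP; rewrite cards_eq0; apply/eqP/setP => m; rewrite !inE.
by apply/andP => -[_ /eqP mz]; move: z0; rewrite -mz.
Qed.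

Lemma v0 k : v 0 k%:Z = (k == 0%N).
Proof. by rewrite v_marked /marked big_seq1 bin0n. Qed.

Lemma v_rec n k :
  (v n.+1 k%:Z)%:Z = (2 * n.+1%:Z - k%:Z - 1) * ((v n k%:Z)%:Z + (v n (k%:Z - 1))%:Z).
Proof.
have -> : v n (k%:Z - 1) = (\sum_(s <- stirling_words n) bin_pred (asc s) k)%N.
  case: k => [|k]; first by rewrite v_neg // big1.
  by rewrite -[RHS]/(marked n k) -v_marked; congr v; lia.
rewrite !v_marked; have := markedS n k; rewrite big_split /= -/(marked n k).
by move: (marked n.+1 k) (marked n k) (\sum_(_ <- _) _)%N => a b c; nia.
Qed.

Lemma v_gt n k : (n < k)%N -> v n k%:Z = 0%N.
Proof.
elim: n k => [|n IH] [|k] // nk; first by rewrite v0.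
apply/eqP; rewrite -eqz_nat v_rec (_ : k.+1%:Z - 1 = k) ?IH ?addr0 ?mulr0 //; lia.
Qed.

(** At size [n + 1] with [n + 1 - k] dots the factor is [2(n+1) - (n+1-k) - 1 = n + k], as on the
    cycle side. All [k] are allowed because the step at [k = n + 1] uses the hypothesis with
    [k > n]. *)
Lemma assoc_stirling1_v n k : assoc_stirling1 n k = v n (n%:Z - k%:Z).
Proof.
rewrite assoc_stirling1E; elim: n k => [|n IH] k.
  by case: k => [|k]; [rewrite v0|rewrite cyclic_derangements_small ?v_neg //; lia].
have [nk|kn] := ltnP n.+1 k.
  by rewrite cyclic_derangements_small ?v_neg //; lia.
have -> : n.+1%:Z - k%:Z = (n.+1 - k)%N by lia.
apply/eqP; rewrite -eqz_nat v_rec; apply/eqP.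
have -> : (n.+1 - k)%N%:Z - 1 = n%:Z - k%:Z by lia.
rewrite -IH addSn; case: k kn => [|k] kn.
  (* For [k = 0] the term with [n + 1] dots at size [n] vanishes, matching the absent term with
     [k - 1] cycles. *)
  rewrite subn0 v_gt // addn0; case: n {IH kn} => // n.
  by rewrite cyclic_derangementsSS; nia.
rewrite addnS cyclic_derangementsSS.
have -> : (n.+1 - k.+1)%N%:Z = n%:Z - k%:Z by lia.
by rewrite -IH; nia.
Qed.

Theorem lemma3p1 :
  [/\ forall n k : nat, (0 < n)%N ->
        (v n k%:Z)%:Z
        = (2 * n%:Z - k%:Z - 1)
          * ((v n.-1 k%:Z)%:Z + (v n.-1 (k%:Z - 1))%:Z),
      forall k : nat, v 0%N k%:Z = (k == 0%N),
      forall n : nat, v n (-1) = 0%N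
    & forall n k : nat, (k <= n)%N ->
        assoc_stirling1 n k = v n (n%:Z - k%:Z)].
Proof.
split=> [[|n] k // _|k|n|n k kn].
- exact: v_rec.
- exact: v0.
- by rewrite v_neg.
exact: assoc_stirling1_v.
Qed.
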